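(* Let $R$ be a commutative finite chain ring of nilpotency index $e$ and residue field $\mathbb{F}_q$, and let $n$ be a positive integer. Then $$d_n(R,a)=d_n(R,1)=q^{e(n^2-1)}\prod_{i=2}^n (1-q^{-i})$$ for all units $a$ in $R$.
   Context: A commutative finite chain ring is a finite commutative ring with identity $1\neq 0$ whose ideals are linearly ordered by inclusion. Such a ring $R$ has a unique maximal ideal, which is principal; let $\gamma$ be a generator of it. The nilpotency index of $R$ is the smallest positive integer $e$ with $\gamma^e=0$. The residue field of $R$ is the finite field $R/\gamma R$; it is $\mathbb{F}_q$, where $q$ is a prime power. For a commutative ring $S$ and $a\in S$, $d_n(S,a)$ denotes the number of $n\times n$ matrices over $S$ whose determinant is $a$. An empty product equals $1$. *)

(* Defs.v *)
From HB Require Import structures.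
From mathcomp Require Import all_boot all_order all_algebra.

Set Implicit Arguments.
Unset Strict Implicit.
Unset Printing Implicit Defensive.
Import GRing.Theory.
Local Open Scope ring_scope.

(* Ideals, the improper one included, are the R-submodules of R acting on
   itself.  MathComp's [idealr R] is the type of the proper ideals of R. *)
Definition is_ideal (R : comNzRingType) (I : {pred R}) : Prop :=
  @GRing.submod_closed R R^o I.

Definition is_chain_ring (R : finComNzRingType) : Prop :=
  forall I J : {pred R}, is_ideal I -> is_ideal J ->
    {subset I <= J} \/ {subset J <= I}.

(* [idealr R] already excludes M = R. *)
Definition is_maximal_ideal (R : comNzRingType) (M : idealr R) : Prop :=
  forall J : {pred R}, is_ideal J -> {subset M <= J} ->
    J =i M \/ J =i predT.

Definition generates (R : comNzRingType) (g : R) (I : idealr R) : Prop :=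
  forall x : R, x \in I <-> exists y : R, x = g * y.

Definition is_nilpotency_index (R : comNzRingType) (g : R) (e : nat) : Prop :=
  [/\ (0 < e)%N, g ^+ e = 0 &
      forall k : nat, (0 < k)%N -> g ^+ k = 0 -> (e <= k)%N].

Definition is_residue_field (R : comNzRingType) (M : idealr R)
    (F : fieldType) : Prop :=
  exists f : {rmorphism {ideal_quot M} -> F}, bijective f.

Definition num_mx_det (n : nat) (S : finComPzRingType) (a : S) : nat :=
  #|[set A : 'M[S]_n | \det A == a]|.
Arguments num_mx_det n S a : clear implicits.

(* Main.v *)
Require Import Defs.
From HB Require Import structures.
From mathcomp Require Import all_boot all_order all_algebra.
From mathcomp Require Import zify ring.
Set Implicit Arguments.
Unset Strict Implicit.
Unset Printing Implicit Defensive.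
Import GRing.Theory Num.Theory.
Local Open Scope ring_scope.

(** Multiplying by a fixed invertible matrix of determinant [a] permutes the
    matrices, so every unit is the determinant of equally many of them, and
    the number sought is the quotient #|GL_n(R)| / #|R^*|.

    Both orders are computed by reduction to the residue field.  A surjective
    additive map between finite groups has fibres of equal size, so the
    preimage of a set has the same density as the set
    ([card_surj_preim]).  Let phi : R -> F be the reduction modulo gamma.  Since
    gamma is nilpotent, an element of [R] is a unit as soon as its image under
    phi is nonzero ([unit_residueE]); as phi commutes with determinants, a
    matrix is invertible over [R] exactly when its reduction is invertible
    over [F].  Hence GL_n(R) has in M_n(R) the density that GL_n(F) has in
    M_n(F), namely the product of the [1 - q ^- i] for i from 1 to n, and R^*
    has in [R] the density [1 - q^-1], which cancels the factor i = 1.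

    There remains the order of [R], which is [q ^ e]: the annihilator of
    [gamma ^ i] grows by a factor [q] with each [i < e], from 0 to [R]
    ([card_residue_exp]). *)

(** The fibre over [f x0] is the translate of the kernel by [x0].  [B] is only
    asked to lie in the image of [f], so that the lemma also applies to
    multiplication by a zero divisor. *)
Lemma card_additive_preim (U V : finZmodType) (f : {additive U -> V})
    (B : {set V}) :
  {in B, forall y, exists x, y = f x} ->
  #|f @^-1: B| = (#|B| * #|f @^-1: [set 0%R]|)%N.
Proof.
move=> onB; rewrite -sum1_card (partition_big f (mem B)) /=; last first.
  by move=> x; rewrite inE.
rewrite -sum_nat_const; apply: eq_bigr => y /[dup] By /onB[x0 yE].
rewrite sum1dep_card -[RHS](card_imset _ (addIr x0)).
apply: eq_card => x; rewrite !inE.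
apply/andP/imsetP => [[_ /eqP fx]|[z]].
  by exists (x - x0); rewrite ?subrK // !inE raddfB /= fx yE subrr.
by rewrite !inE => /eqP fz ->; rewrite raddfD /= fz add0r -yE.
Qed.

(** Equality of the densities of [f @^-1: B] in [U] and of [B] in [V], freed
    of denominators. *)
Lemma card_surj_preim (U V : finZmodType) (f : {additive U -> V})
    (B : {set V}) :
  (forall y, exists x, y = f x) -> (#|f @^-1: B| * #|V| = #|B| * #|U|)%N.
Proof.
move=> onf; rewrite card_additive_preim; last by move=> y _; exact: onf.
have := @card_additive_preim U V f setT (fun y _ => onf y).
by rewrite preimsetT !cardsT => ->; rewrite -mulnA [(_ * #|V|)%N]mulnC.
Qed.

(** The residue field serves only through its reduction map, which avoids
    working with representatives in the quotient. *)
Lemma residue_morphism (R : comNzRingType) (M : idealr R) (F : fieldType) :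
  is_residue_field M F ->
  exists phi : {rmorphism R -> F},
    (forall y, exists x, y = phi x) /\ (forall x, (phi x == 0) = (x \in M)).
Proof.
case=> f [g fK gK]; exists (f \o \pi_{ideal_quot M}%qT); split=> [y|x] /=.
  by exists (repr (g y)); rewrite /= reprK gK.
rewrite -(rmorph0 f) (can_eq fK) -(rmorph0 (\pi_{ideal_quot M}%qT)).
by rewrite -Quotient.idealrBE subr0.
Qed.

(** If [z] lifts the inverse of [phi x], then [x * z] is 1 minus a multiple of
    the nilpotent [g], and the geometric series inverts it. *)
Lemma unit_residueE (R : comUnitRingType) (F : fieldType)
    (phi : {rmorphism R -> F}) (g : R) (e : nat) :
  (forall y, exists x, y = phi x) ->
  (forall x, phi x = 0 <-> exists y, x = g * y) -> g ^+ e = 0 ->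
  forall x, (x \is a GRing.unit) = (phi x != 0).
Proof.
move=> onphi kerphi ge0 x; apply/idP/idP => [Ux|phix_neq0].
  by rewrite -unitfE rmorph_unit.
have [z phiz] := onphi (phi x)^-1.
have /kerphi[y xzE] : phi (1 - x * z) = 0.
  by rewrite rmorphB rmorph1 rmorphM -phiz mulfV // subrr.
suff: x * z \is a GRing.unit by rewrite unitrM => /andP[].
apply/unitrPr; exists (\sum_(i < e) (g * y) ^+ i).
rewrite -[x * z](subKr 1) xzE -opprB mulNr -subrX1 exprMn ge0 mul0r sub0r.
by rewrite opprK.
Qed.

(** Write Ann(h) for the kernel of multiplication by [h].  Comparing the
    kernel-image counts of multiplication by [g] and of [phi], where the image
    of the former is the kernel of the latter, gives #|Ann(g)| = #|F|.  For
    [i < e], Ann(g) lies in the image of multiplication by [g ^+ i], and its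
    preimage is Ann(g ^+ i.+1); so each step up to [e] multiplies
    #|Ann(g ^+ i)| by #|F|, and Ann(g ^+ e) is the whole ring. *)
Lemma card_residue_exp (R : finComUnitRingType) (F : finFieldType)
    (phi : {rmorphism R -> F}) (g : R) (e : nat) :
  (forall y, exists x, y = phi x) ->
  (forall x, phi x = 0 <-> exists y, x = g * y) ->
  is_nilpotency_index g e -> #|R| = (#|F| ^ e)%N.
Proof.
move=> onphi kerphi [e_gt0 ge0 ge_min].
have unitE := unit_residueE onphi kerphi ge0.
have gX_neq0 i : (i < e)%N -> g ^+ i != 0.
  case: i => [|i] lt_ie; first by rewrite expr0 oner_neq0.
  by apply/eqP => /(ge_min i.+1 isT); rewrite leqNgt lt_ie.
pose mulg (h : R) : {additive R -> R} := h \*o idfun.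
have card_ann : #|mulg g @^-1: [set 0%R]| = #|F|.
  have kerE : phi @^-1: [set 0%R] = mulg g @: [set: R].
    apply/setP=> x; rewrite !inE; apply/eqP/imsetP => [/kerphi[y ->]|[y _ ->]].
      by exists y.
    by apply/kerphi; exists y.
  have imE : mulg g @^-1: (mulg g @: [set: R]) = setT.
    by apply/setP=> x; rewrite !inE imset_f.
  have := @card_additive_preim _ _ phi setT (fun y _ => onphi y).
  have := @card_additive_preim _ _ (mulg g) (mulg g @: [set: R]).
  rewrite preimsetT imE kerE => -> => [|_ /imsetP[y _ ->]]; last by exists y.
  rewrite cardsT mulnC => /eqP; rewrite eqn_pmul2r; first by move/eqP.
  by apply/card_gt0P; exists (mulg g 0); rewrite imset_f.
have ann_sub i x : (i < e)%N -> g * x = 0 -> exists y, x = g ^+ i * y.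
  (* If [x = g ^+ i * y] with [y] a unit, then [g * x = 0] would kill
     [g ^+ i.+1]; so [y] is a multiple of [g], and one more [g] comes out. *)
  elim: i => [|i IHi] lt_ie gx0; first by exists x; rewrite mul1r.
  have [y xE] := IHi (ltnW lt_ie) gx0.
  have : y \isn't a GRing.unit.
    apply: contra (gX_neq0 _ lt_ie) => Uy.
    by rewrite -(mulIr_eq0 _ (mulIr Uy)) exprS -mulrA -xE gx0.
  rewrite unitE negbK => /eqP/kerphi[z yE].
  by exists z; rewrite exprSr -mulrA -yE.
have card_annX i :
    (i <= e)%N -> #|mulg (g ^+ i) @^-1: [set 0%R]| = (#|F| ^ i)%N.
  elim: i => [|i IHi] lt_ie.
    rewrite -[RHS](cards1 (0 : R)); apply: eq_card => x.
    by rewrite !inE /= mul1r.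
  rewrite expnSr -{}IHi 1?ltnW // mulnC -card_ann -card_additive_preim.
    by apply: eq_card => x; rewrite !inE /= mulrA -exprS.
  by move=> y; rewrite !inE => /eqP/(ann_sub i)-/(_ lt_ie).
rewrite -card_annX // -cardsT; apply: eq_card => x.
by rewrite !inE /= ge0 mul0r eqxx.
Qed.

(** Right multiplication by diag(a, 1, ..., 1) is a bijection from the matrices
    of determinant 1 to those of determinant [a]. *)
Lemma card_mx_det_unit (R : finComUnitRingType) (n : nat) (a : R) :
  (0 < n)%N -> a \is a GRing.unit -> num_mx_det n R a = num_mx_det n R 1.
Proof.
case: n => // n _ Ua; pose d : 'rV[R]_n.+1 := \row_j (if j == 0 then a else 1).
have detD : \det (diag_mx d) = a.
  rewrite det_diag (bigD1 0) //= big1 => [|j /negPf j0]; rewrite !mxE ?j0 //.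
  by rewrite mulr1.
have UD : diag_mx d \in unitmx by rewrite unitmxE detD.
rewrite /num_mx_det -[RHS](card_imset _ (can_inj (mulmxK UD))).
apply: eq_card => A; rewrite !inE; apply/eqP/imsetP => [detA|[B]].
  exists (A *m invmx (diag_mx d)); last by rewrite mulmxKV.
  by rewrite inE det_mulmx det_inv detD detA divrr.
by rewrite inE => /eqP detB ->; rewrite det_mulmx detB detD mul1r.
Qed.

Lemma card_unitmx_det (R : finComUnitRingType) (n : nat) : (0 < n)%N ->
  #|[set A : 'M[R]_n | \det A \is a GRing.unit]| =
    (#|[set x : R | x \is a GRing.unit]| * num_mx_det n R 1%R)%N.
Proof.
move=> n_gt0; rewrite -sum1_card.
rewrite (partition_big (fun A => \det A) [in [set x : R | x \is a GRing.unit]]).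
  rewrite -sum_nat_const; apply: eq_bigr => a; rewrite inE => Ua.
  rewrite sum1dep_card -(card_mx_det_unit n_gt0 Ua); apply: eq_card => A.
  by rewrite !inE andb_idl // => /eqP->.
by move=> A; rewrite !inE.
Qed.

Lemma bin2_add_binS2 n : ('C(n, 2) + 'C(n.+1, 2) = n ^ 2)%N.
Proof.
elim: n => // n; rewrite -!mulnn.
by have := binS n 1; have := binS n.+1 1; rewrite !bin1; lia.
Qed.

(** The order of GL_n(F) in the shape of a density: factoring [q ^ i] out of
    each [q ^ i - 1] completes [q ^ 'C(n, 2)] to [q ^ (n ^ 2)]. *)
Lemma card_field_unitmx (F : finFieldType) (n : nat) : (0 < n)%N ->
  #|[set A : 'M[F]_n | \det A != 0]|%:R =
    #|F|%:R ^+ (n ^ 2) * \prod_(1 <= i < n.+1) (1 - #|F|%:R ^- i) :> rat.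
Proof.
move=> n_gt0; set q := #|F|.
have q_neq0 : q%:R != 0 :> rat.
  by rewrite pnatr_eq0 -lt0n (ltn_trans _ (card_finNzRing_gt1 F)).
have -> : #|[set A : 'M[F]_n | \det A != 0]| = #|'GL_n[F]%g|.
  case: n n_gt0 => // n _; rewrite cardsT /= card_sub.
  by apply: eq_card => A; rewrite !inE -unitfE.
rewrite card_GL // -/q natrM natrX natr_prod.
have factorE i : (q ^ i - 1)%:R = q%:R ^+ i * (1 - q%:R ^- i) :> rat.
  rewrite mulrBr mulr1 divff ?expf_neq0 // natrB ?natrX //.
  by rewrite expn_gt0 ltnW // card_finNzRing_gt1.
rewrite (eq_bigr _ (fun i _ => factorE i)).
rewrite big_split /= prodrXr mulrA -exprD; congr (_ ^+ _ * _).
by rewrite -bin2_add_binS2 -(bin2_sum n.+1) [in RHS]big_ltn.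
Qed.

(** Entrywise reduction is additive and onto, and the invertible matrices over
    [R] are the preimage of those over [F]. *)
Lemma card_unitmx_residue (R : finComUnitRingType) (F : finFieldType)
    (phi : {rmorphism R -> F}) (n : nat) :
  (forall y, exists x, y = phi x) ->
  (forall x, (x \is a GRing.unit) = (phi x != 0)) ->
  (#|[set A : 'M[R]_n | \det A \is a GRing.unit]| * #|F| ^ (n ^ 2) =
     #|[set A : 'M[F]_n | \det A != 0%R]| * #|R| ^ (n ^ 2))%N.
Proof.
move=> onphi unitE; rewrite -!mulnn -!(card_mx _ n n).
have onmx (B : 'M[F]_n) : exists A : 'M[R]_n, B = map_mx phi A.
  have onE i j : exists x, B i j == phi x.
    by have [x ->] := onphi (B i j); exists x.
  exists (\matrix_(i, j) xchoose (onE i j)); apply/matrixP=> i j.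
  by rewrite !mxE; apply/eqP/(xchooseP (onE i j)).
rewrite -(card_surj_preim _ onmx); congr (_ * _)%N; apply: eq_card => A.
by rewrite !inE unitE det_map_mx.
Qed.

Theorem corollary3p6 (R : finComUnitRingType) (M : idealr R) (gamma : R)
    (e : nat) (F : finFieldType) (q n : nat)
    (chainR : is_chain_ring R)
    (maxM : is_maximal_ideal M)
    (genM : generates gamma M)
    (nilp : is_nilpotency_index gamma e)
    (resF : is_residue_field M F)
    (cardF : #|F| = q)
    (n_gt0 : (0 < n)%N) :
  forall a : R, a \is a GRing.unit ->
    num_mx_det n R a = num_mx_det n R 1 /\
    (num_mx_det n R 1)%:R =
      q%:R ^+ (e * (n ^ 2 - 1)) * \prod_(2 <= i < n.+1) (1 - q%:R ^- i) :> rat.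
Proof.
move=> a Ua; split; first exact: card_mx_det_unit.
have [phi [onphi phi0]] := residue_morphism resF.
have kerphi x : phi x = 0 <-> exists y, x = gamma * y.
  by rewrite -genM -phi0; split=> /eqP.
have unitE : forall x, (x \is a GRing.unit) = (phi x != 0).
  by case: nilp => _ ge0 _; exact: unit_residueE onphi kerphi ge0.
have cardR := card_residue_exp onphi kerphi nilp.
have q_gt1 : (1 < q)%N by rewrite -cardF card_finNzRing_gt1.
have q_neq0 : q%:R != 0 :> rat by rewrite pnatr_eq0 -lt0n ltnW.
have qB1_neq0 : q%:R - 1 != 0 :> rat.
  by rewrite subr_eq0 -[1]/(1%:R) eqr_nat neq_ltn q_gt1 orbT.
have /(congr1 (GRing.natmul (1 : rat))) cardU :
    (#|[set x : R | x \is a GRing.unit]| * q = (q - 1) * q ^ e)%N.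
  rewrite -cardF -cardR subn1 -(cardsC1 (0 : F)) -(card_surj_preim _ onphi).
  by congr (_ * _)%N; apply: eq_card => x; rewrite !inE unitE.
have /(congr1 (GRing.natmul (1 : rat))) := card_unitmx_residue n onphi unitE.
rewrite card_unitmx_det // !natrM card_field_unitmx // cardR cardF.
rewrite big_ltn // -expnM.
move: cardU; rewrite !natrM !natrX natrB 1?ltnW //.
set x := q%:R; set u := _%:R; set P := \prod_(_ <= _ < _) _.
set d := (num_mx_det n R 1)%:R => cardU cardGL.
have expE : x ^+ (e * n ^ 2) = x ^+ (e * (n ^ 2 - 1)) * x ^+ e.
  by rewrite -exprD -mulnSr subn1 prednK // expn_gt0 n_gt0.
(* Clearing #|R^*| and [q ^ (n ^ 2)] turns the claim into the two counts. *)
have nz : (x - 1) * x ^+ e * x ^+ (n ^ 2) != 0.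
  by rewrite !mulf_neq0 // expf_neq0.
have subV1 : (1 - x ^- 1) * x = x - 1 by rewrite mulrBl mul1r mulVf.
apply: (mulfI nz); rewrite -{1}cardU.
transitivity (u * d * x ^+ (n ^ 2) * x); first by ring.
by rewrite cardGL expE -{}subV1; ring.
Qed.
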